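(* Let $T>0$ and let $U\in C^1\big([0,T);(H_0^1(\Omega))^N\big)$ be a solution of $$\frac{\mathrm{d}U}{\mathrm{d}t}=\mathcal{G}U-U\langle \mathcal{G}U,U\rangle,\qquad U(0)=U_0,$$ with initial data $U_0\in\mathcal{M}^N_{\geqslant}$. Then $$\frac{\mathrm{d}}{\mathrm{d}t}E(U(t))\leqslant 0\quad\text{for all } t\in[0,T).$$
   Context: $\Omega\subset\mathbb{R}^d$ is a bounded domain, and $(\cdot,\cdot)$, $\|\cdot\|$ denote the $L^2(\Omega)$ inner product and norm. $\mathcal{V}:\Omega\to\mathbb{R}$ is a potential such that the bilinear form $a(u,v)=\int_\Omega(\nabla u\cdot\nabla v+\mathcal{V}uv)\,dx$ on $H_0^1(\Omega)$ is symmetric, bounded and coercive, i.e. there are constants $c_1,c_2>0$ with $c_1\|\nabla u\|^2\leqslant a(u,u)\leqslant c_2\|\nabla u\|^2$ for all $u\in H_0^1(\Omega)$. $\mathcal{G}=(-\Delta+\mathcal{V})^{-1}$: for $f\in H^{-1}(\Omega)$, $\mathcal{G}f\in H_0^1(\Omega)$ is the unique element with $a(\mathcal{G}f,v)=\langle f,v\rangle$ for all $v\in H_0^1(\Omega)$. For $N$-tuples $U=(u_1,\dots,u_N)$ and $V=(v_1,\dots,v_N)$: - $\mathcal{G}U=(\mathcal{G}u_1,\dots,\mathcal{G}u_N)$; - for a matrix $A\in\mathbb{R}^{N\times N}$, $UA$ is the tuple with $j$-th entry $\sum_i u_iA_{ij}$; - $\langle U,V\rangle=((u_i,v_j))_{i,j=1}^N$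 and $\langle U,V\rangle_a=(a(u_i,v_j))_{i,j=1}^N$; - $(U,V)_a=\operatorname{tr}\langle U,V\rangle_a$. The energy is $E(U)=\frac12(U,U)_a$. For symmetric matrices, $A\leqslant B$ means $B-A$ is positive semidefinite. The quasi-Stiefel set is $\mathcal{M}^N_{\geqslant}=\{U\in(H_0^1(\Omega))^N:\langle U,U\rangle\geqslant I_N\}$. *)

(* Defs.v *)
From HB Require Import structures.
From mathcomp Require Import all_boot all_order all_algebra.
From mathcomp Require Import all_classical all_reals all_analysis.
Set Implicit Arguments. Unset Strict Implicit. Unset Printing Implicit Defensive.
Import Order.TTheory GRing.Theory Num.Theory.
Import numFieldNormedType.Exports.
Local Open Scope classical_set_scope.
Local Open Scope ring_scope.

(* ---------- abstract functional setting ----------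
   H plays the role of H_0^1(Omega), equipped with the complete norm
   ||grad u||;  ip = L^2 inner product (.,.);  a = the bilinear form
   a(u,v) = int grad u . grad v + V u v;  G = (-Delta + V)^{-1}. *)

Definition sym_bilinear (R : realType) (H : lmodType R) (b : H -> H -> R) :=
  (forall u v, b u v = b v u) /\
  (forall k u v w, b (k *: u + v) w = k * b u w + b v w).

(* The norm of H is a Hilbert norm (it is ||grad u||, induced by the
   Dirichlet form (grad u, grad v)). *)
Definition hilbert_norm (R : realType) (H : normedModType R) :=
  exists g : H -> H -> R, sym_bilinear g /\ forall u : H, g u u = `|u| ^+ 2.

(* (.,.) is the L^2 inner product restricted to H_0^1: symmetric, bilinear,
   positive definite, and continuous for ||grad .|| (Poincare inequality). *)
Definition L2_inner (R : realType) (H : normedModType R) (ip : H -> H -> R) :=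
  [/\ sym_bilinear ip,
      (forall u : H, u != 0 -> 0 < ip u u) &
      exists C : R, 0 < C /\ forall u : H, ip u u <= C * `|u| ^+ 2].

Definition coercive_form (R : realType) (H : normedModType R) (a : H -> H -> R) :=
  sym_bilinear a /\
  exists c1 c2 : R, [/\ 0 < c1, 0 < c2 &
     forall u : H, c1 * `|u| ^+ 2 <= a u u /\ a u u <= c2 * `|u| ^+ 2].

Definition green_op (R : realType) (H : normedModType R)
  (a ip : H -> H -> R) (G : H -> H) := forall u v : H, a (G u) v = ip u v.

Definition tmap (R : realType) (H : lmodType R) (N : nat) (G : H -> H)
  (U : 'I_N -> H) : 'I_N -> H := fun i => G (U i).

Definition tmul (R : realType) (H : lmodType R) (N : nat)
  (U : 'I_N -> H) (A : 'M[R]_N) : 'I_N -> H :=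
  fun j => \sum_(i < N) A i j *: U i.

Definition gram (R : realType) (H : lmodType R) (N : nat)
  (b : H -> H -> R) (U V : 'I_N -> H) : 'M[R]_N :=
  \matrix_(i, j) b (U i) (V j).

Definition energy (R : realType) (H : lmodType R) (N : nat)
  (a : H -> H -> R) (U : 'I_N -> H) : R :=
  2^-1 * \tr (gram a U U).

Definition psd (R : realType) (N : nat) (A : 'M[R]_N) :=
  forall v : 'cV[R]_N, 0 <= (v^T *m A *m v) 0 0.
Definition loewner_le (R : realType) (N : nat) (A B : 'M[R]_N) := psd (B - A).

Definition quasi_stiefel (R : realType) (H : lmodType R) (N : nat)
  (ip : H -> H -> R) (U : 'I_N -> H) :=
  loewner_le 1%:M (gram ip U U).

Definition deriv_on (R : realType) (V : normedModType R) (T : R)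
  (f f' : R -> V) :=
  forall t : R, 0 <= t < T ->
    (fun h : R => h^-1 *: (f (t + h) - f t))
      @ (within (fun h : R => h != 0 /\ 0 <= t + h < T) (nbhs (0 : R)))
      --> f' t.

Definition continuous_on_0T (R : realType) (V : normedModType R) (T : R)
  (f : R -> V) := {within [set x : R | 0 <= x < T], continuous f}.

(* Main.v *)
Require Import Defs.
From HB Require Import structures.
From mathcomp Require Import all_boot all_order all_algebra.
From mathcomp Require Import all_classical all_reals all_analysis.
From mathcomp Require Import ring lra.
Import Order.TTheory GRing.Theory Num.Theory.
Import numFieldNormedType.Exports.
Local Open Scope classical_set_scope.
Local Open Scope ring_scope.

(** Write [S = <U,U>], [K = <GU,U>] and [D = S - I].  The flow gives
    [D' = - (K D + D K)], and such a Lyapunov equation preserves positive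
    semidefiniteness, so [S >= I] for all times.  On the other hand
    [dE/dt = tr S - \sum_(i, j) a(w_i, w_j) a(u_i, u_j)] with [w = G u], and
    since [a(w_i, u_j) = S_ij], Cauchy-Schwarz between
    [\sum_i w_i (x) u_i] and its flip in the tensor square bounds the double
    sum below by [\sum_(i, j) S_ij^2], which is at least [tr S] when [S >= I]. *)

(** * Symmetric bilinear forms and Gram matrices *)

Section SymmetricBilinear.
Context {R : realType} {H : lmodType R} {b : H -> H -> R}.
Hypothesis b_symbil : sym_bilinear b.

Lemma symbilC u v : b u v = b v u.
Proof. exact: (proj1 b_symbil). Qed.

Lemma symbil0l u : b 0 u = 0.
Proof.
have := (proj2 b_symbil) (-1) u u u.
by rewrite scaleN1r addNr mulN1r addNr.
Qed.

Lemma symbilDl u v w : b (u + v) w = b u w + b v w.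
Proof. by have := (proj2 b_symbil) 1 u v w; rewrite scale1r mul1r. Qed.

Lemma symbilZl k u v : b (k *: u) v = k * b u v.
Proof. by have := (proj2 b_symbil) k u 0 v; rewrite addr0 symbil0l addr0. Qed.

Lemma symbilNl u v : b (- u) v = - b u v.
Proof. by rewrite -scaleN1r symbilZl mulN1r. Qed.

Lemma symbilBl u v w : b (u - v) w = b u w - b v w.
Proof. by rewrite symbilDl symbilNl. Qed.

Lemma symbilDr u v w : b w (u + v) = b w u + b w v.
Proof. by rewrite symbilC symbilDl !(symbilC w). Qed.

Lemma symbilZr k u v : b v (k *: u) = k * b v u.
Proof. by rewrite symbilC symbilZl (symbilC v). Qed.

Lemma symbilNr u v : b v (- u) = - b v u.
Proof. by rewrite symbilC symbilNl (symbilC v). Qed.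

Lemma symbilBr u v w : b w (u - v) = b w u - b w v.
Proof. by rewrite symbilC symbilBl !(symbilC w). Qed.

Lemma symbil_suml (I : Type) (r : seq I) (P : pred I) (F : I -> H) u :
  b (\sum_(i <- r | P i) F i) u = \sum_(i <- r | P i) b (F i) u.
Proof.
by apply: (big_morph (fun x => b x u)) => [x y|]; rewrite ?symbilDl ?symbil0l.
Qed.

Lemma symbil_sumr (I : Type) (r : seq I) (P : pred I) (F : I -> H) u :
  b u (\sum_(i <- r | P i) F i) = \sum_(i <- r | P i) b u (F i).
Proof. by rewrite symbilC symbil_suml; apply: eq_bigr => i _; rewrite symbilC. Qed.

Lemma gram_quad (N : nat) (X : 'I_N -> H) (v : 'cV[R]_N) :
  (v^T *m gram b X X *m v) 0 0 =
  b (\sum_i v i 0 *: X i) (\sum_i v i 0 *: X i).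
Proof.
rewrite !mxE symbil_sumr; apply: eq_bigr => j _.
rewrite !mxE symbilZr symbil_suml mulrC; congr (_ * _).
by apply: eq_bigr => i _; rewrite !mxE symbilZl.
Qed.

Lemma gram_psd (N : nat) (X : 'I_N -> H) :
  (forall u, 0 <= b u u) -> psd (gram b X X).
Proof. by move=> b_ge0 v; rewrite gram_quad. Qed.

Lemma posdef_ge0 : (forall u, u != 0 -> 0 < b u u) -> forall u, 0 <= b u u.
Proof.
by move=> b_gt0 u; have [->|/b_gt0/ltW//] := eqVneq u 0; rewrite symbil0l.
Qed.

Lemma cauchy_schwarz u v :
  (forall w, w != 0 -> 0 < b w w) -> b u v ^+ 2 <= b u u * b v v.
Proof.
move=> b_gt0; have [->|/b_gt0 v_gt0] := eqVneq v 0.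
  by rewrite !(symbilC _ 0) !symbil0l mulr0 expr0n.
(* Expanding the form at this vector gives [b v v] times [b u u * b v v - b u v ^+ 2]. *)
have := posdef_ge0 b_gt0 (b v v *: u - b u v *: v).
rewrite symbilBl !symbilBr !symbilZl !symbilZr (symbilC v u) => h.
rewrite -subr_ge0 -(pmulr_rge0 _ v_gt0); apply: le_trans h _.
by rewrite le_eqVlt; apply/orP; left; apply/eqP; ring.
Qed.

(* One Gram-Schmidt step on [y 0]: with [y k = p k *: y 0 + z k] and
   [z k] orthogonal to [y 0] the sum splits into a square and a sum over
   [x], [z] in which the index 0 no longer contributes. *)
Lemma gram_hadamard_sum_ge0 (n : nat) (x y : 'I_n -> H) :
  (forall u, u != 0 -> 0 < b u u) ->
  0 <= \sum_k \sum_l b (x k) (x l) * b (y k) (y l).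
Proof.
move=> b_gt0.
have b_ge0 := posdef_ge0 b_gt0.
elim: n x y => [|n IHn] x y; first by rewrite big_ord0.
(* If [y0 = 0] the division by zero is harmless: [p k] is only ever multiplied by something that
   vanishes, so [z_orth] and [z0] survive. *)
pose y0 := y ord0; pose p k := b (y k) y0 / b y0 y0.
pose z k := y k - p k *: y0.
have z_orth k : b (z k) y0 = 0.
  rewrite /z symbilBl symbilZl /p; have [->|/b_gt0/gt_eqF e] := eqVneq y0 0.
    by rewrite !(symbilC _ 0) !symbil0l mulr0 subr0.
  by rewrite divfK ?subrr // e.
have z0 : z ord0 = 0.
  rewrite /z /p -/y0; have [->|/b_gt0/gt_eqF e] := eqVneq y0 0.
    by rewrite scaler0 subr0.
  by rewrite divff ?e // scale1r subrr.
have yD k : y k = z k + p k *: y0 by rewrite subrK.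
clearbody z p.
have yE k l : b (y k) (y l) = p k * p l * b y0 y0 + b (z k) (z l).
  rewrite !yD symbilDl !symbilDr !symbilZl !symbilZr (symbilC y0 (z l)) !z_orth.
  ring.
pose X := \sum_k p k *: x k.
have -> : \sum_k \sum_l b (x k) (x l) * b (y k) (y l) =
    b y0 y0 * b X X + \sum_k \sum_l b (x k) (x l) * b (z k) (z l).
  rewrite symbil_suml mulr_sumr -big_split; apply: eq_bigr => k _ /=.
  rewrite symbil_sumr mulr_sumr -big_split; apply: eq_bigr => l _ /=.
  by rewrite yE symbilZl symbilZr; ring.
apply: addr_ge0; first exact: mulr_ge0.
rewrite big_ord_recl big1 ?add0r => [|l _]; last by rewrite z0 symbil0l mulr0.
have := IHn (fun k => x (lift ord0 k)) (fun k => z (lift ord0 k)).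
congr (_ <= _); apply: eq_bigr => k _.
by rewrite big_ord_recl z0 (symbilC _ 0) symbil0l mulr0 add0r.
Qed.

(* Positivity of the square of [\sum_i (w i (x) u i - u i (x) w i)] in the
   tensor square of [H]. *)
Lemma gram_swap_le (N : nat) (u w : 'I_N -> H) :
  (forall x, x != 0 -> 0 < b x x) ->
  \sum_i \sum_j b (w i) (u j) * b (u i) (w j) <=
  \sum_i \sum_j b (w i) (w j) * b (u i) (u j).
Proof.
move=> b_gt0.
(* The concatenated families [x = (w, u)] and [y = (u, - w)] encode the antisymmetrized tensor as a
   single sum of [x k (x) y k]. Its square contains each of the two double sums twice, hence the
   factor 2 below. *)
pose x (k : 'I_(N + N)) := match fintype.split k with inl i => w i | inr i => u i end.
pose y (k : 'I_(N + N)) := match fintype.split k with inl i => u i | inr i => - w i end.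
have xl i : x (lshift N i) = w i by rewrite /x (unsplitK (inl i)).
have xr i : x (rshift N i) = u i by rewrite /x (unsplitK (inr i)).
have yl i : y (lshift N i) = u i by rewrite /y (unsplitK (inl i)).
have yr i : y (rshift N i) = - w i by rewrite /y (unsplitK (inr i)).
have := gram_hadamard_sum_ge0 _ x y b_gt0.
have -> : \sum_k \sum_l b (x k) (x l) * b (y k) (y l) =
    2 * (\sum_i \sum_j b (w i) (w j) * b (u i) (u j) -
         \sum_i \sum_j b (w i) (u j) * b (u i) (w j)).
  rewrite big_split_ord /= mulrC mulrBl !mulr_suml -sumrB -big_split /=.
  apply: eq_bigr => i _; rewrite !mulr_suml -sumrB.
  rewrite !big_split_ord /= -!big_split /=; apply: eq_bigr => j _.
  by rewrite !(xl, xr, yl, yr) !(symbilNl, symbilNr); ring.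
by rewrite pmulr_rge0 ?ltr0n // subr_ge0.
Qed.

End SymmetricBilinear.

(** * Positive semidefinite matrices *)

Section Psd.
Context {R : realType} {N : nat}.
Implicit Types A B K : 'M[R]_N.

Lemma psdD A B : psd A -> psd B -> psd (A + B).
Proof. by move=> hA hB v; rewrite mulmxDr mulmxDl mxE addr_ge0. Qed.

Lemma psdZ k A : 0 <= k -> psd A -> psd (k *: A).
Proof. by move=> k0 hA v; rewrite -scalemxAr -scalemxAl mxE mulr_ge0. Qed.

Lemma psd_congr A B : psd A -> psd (B^T *m A *m B).
Proof. by move=> hA v; have := hA (B *m v); rewrite trmx_mul !mulmxA. Qed.

Lemma psd_diag_ge0 A i : psd A -> 0 <= A i i.
Proof.
move=> /(_ (delta_mx i 0)); rewrite trmx_delta -rowE -colE.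
by rewrite !mxE.
Qed.

Lemma psd_trace_ge0 A : psd A -> 0 <= \tr A.
Proof. by move=> hA; apply: sumr_ge0 => i _; exact: psd_diag_ge0. Qed.

Lemma quad_formE A (v : 'cV[R]_N) :
  (v^T *m A *m v) 0 0 = \sum_j \sum_i v i 0 * A i j * v j 0.
Proof.
rewrite !mxE; apply: eq_bigr => j _; rewrite !mxE mulr_suml.
by apply: eq_bigr => i _; rewrite !mxE.
Qed.

(** The diagonal term [e * |v|^2] is shared equally among the pairs of indices. The share of
    [(i, j)] is [e / N] times the mean of [v_i^2] and [v_j^2], which dominates [|v_i A_ij v_j|]. *)
Lemma psd_scalar_perturb (e : R) A :
  (forall i j, N%:R * `|A i j| <= e) -> psd (e%:M + A).
Proof.
move=> hA v; rewrite mulmxDr mulmxDl mul_mx_scalar -scalemxAl.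
rewrite mxE quad_formE mxE.
have -> : (v^T *m v) 0 0 = \sum_i v i 0 ^+ 2.
  by rewrite mxE; apply: eq_bigr => i _; rewrite !mxE expr2.
have [N0|N0] := posnP N.
  by rewrite !big1 ?mulr0 ?addr0 // => i _; have := ltn_ord i; rewrite [X in (_ < X)%N]N0.
have Ngt0 : 0 < N%:R :> R by rewrite ltr0n.
have -> : e * (\sum_i v i 0 ^+ 2) =
    \sum_(j < N) \sum_(i < N) e / N%:R * ((v i 0 ^+ 2 + v j 0 ^+ 2) / 2).
  pose X := \sum_i v i 0 ^+ 2.
  have sumi : \sum_(j < N) \sum_i v i 0 ^+ 2 = N%:R * X.
    by rewrite sumr_const card_ord mulr_natl.
  have sumj : \sum_(j < N) \sum_(i < N) v j 0 ^+ 2 = N%:R * X.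
    by rewrite exchange_big.
  transitivity (e / N%:R / 2 * (\sum_(j < N) \sum_(i < N) v i 0 ^+ 2 +
                                \sum_(j < N) \sum_(i < N) v j 0 ^+ 2)).
    by rewrite sumi sumj -/X; field; exact: lt0r_neq0.
  rewrite -big_split mulr_sumr; apply: eq_bigr => j _.
  rewrite -big_split mulr_sumr; apply: eq_bigr => i _ /=.
  by field; exact: lt0r_neq0.
rewrite -big_split; apply: sumr_ge0 => j _ /=.
rewrite -big_split; apply: sumr_ge0 => i _ /=.
have {}hA : `|A i j| <= e / N%:R by rewrite ler_pdivlMr // mulrC.
move: hA; set q := e / _; set x := v i 0; set z := v j 0; rewrite ler_norml.
move=> /andP[h1 h2].
(* Both weights [A i j + q] and [q - A i j] are nonnegative because [|A i j| <= q]. *)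
have -> : q * ((x ^+ 2 + z ^+ 2) / 2) + x * A i j * z =
    ((A i j + q) * (x + z) ^+ 2 + (q - A i j) * (x - z) ^+ 2) / 4 by field.
by rewrite divr_ge0 // addr_ge0 // mulr_ge0 ?sqr_ge0 //; lra.
Qed.

End Psd.

(** * Continuity of bounded bilinear forms *)

Section Limits.
Context {R : realType}.

Lemma bounded_symbil_norm {H : normedModType R} (b : H -> H -> R) (C : R) :
  sym_bilinear b -> (forall u, u != 0 -> 0 < b u u) -> 0 <= C ->
  (forall u, b u u <= C * `|u| ^+ 2) ->
  forall u v, `|b u v| <= C * `|u| * `|v|.
Proof.
move=> bS b_gt0 C0 bC u v.
rewrite -(@ler_pXn2r _ 2) ?nnegrE ?mulr_ge0 // real_normK ?num_real //.
apply: le_trans (cauchy_schwarz bS u v b_gt0) _.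
have -> : (C * `|u| * `|v|) ^+ 2 = (C * `|u| ^+ 2) * (C * `|v| ^+ 2) by ring.
by apply: ler_pM => //; exact: posdef_ge0.
Qed.

Lemma cvg_bounded_symbil {H : normedModType R} (b : H -> H -> R) (C : R)
    {I : Type} (F : set_system I) (FF : Filter F) (f g : I -> H) (l m : H) :
  sym_bilinear b -> (forall u v, `|b u v| <= C * `|u| * `|v|) ->
  f x @[x --> F] --> l -> g x @[x --> F] --> m ->
  b (f x) (g x) @[x --> F] --> b l m.
Proof.
move=> bS bC fl gm; apply/subr_cvg0/norm_cvg0P.
have fl0 : `|f x - l| @[x --> F] --> 0 by apply/norm_cvg0P/subr_cvg0.
have gm0 : `|g x - m| @[x --> F] --> 0 by apply/norm_cvg0P/subr_cvg0.
have lim0 : C * `|f x - l| * `|g x| + C * `|l| * `|g x - m| @[x --> F] --> 0.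
  have -> : 0 = C * 0 * `|m| + C * `|l| * 0 :> R by ring.
  apply: cvgD.
    apply: cvgM; last exact: cvg_norm.
    by apply: cvgM => //; exact: cvg_cst.
  by apply: cvgM => //; exact: cvg_cst.
apply: squeeze_cvgr (cvg_cst 0) lim0; apply: nearW => x; rewrite normr_ge0 /=.
have -> : b (f x) (g x) - b l m = b (f x - l) (g x) + b l (g x - m).
  by rewrite (symbilBl bS) (symbilBr bS); ring.
by apply: le_trans (ler_normD _ _) _; apply: lerD; exact: bC.
Qed.

Lemma cvg_sumr {I : Type} (F : set_system I) (FF : Filter F) (n : nat)
    (f : 'I_n -> I -> R) (l : 'I_n -> R) :
  (forall i, f i x @[x --> F] --> l i) ->
  \sum_i f i x @[x --> F] --> \sum_i l i.
Proof. by move=> fl; apply: cvg_big => //; exact: add_continuous. Qed.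

(** * Calculus of difference quotients on [[0, T)] *)

Section DerivOn.
Variable T : R.

Lemma deriv_on_cvg {V : normedModType R} (f f' : R -> V) (t : R) :
  deriv_on T f f' -> 0 <= t < T ->
  f (t + h) @[h --> within (fun h => h != 0 /\ 0 <= t + h < T) (nbhs 0)] --> f t.
Proof.
move=> df tT; set F := within _ _.
have FF : Filter F by apply: within_filter.
have idF : h @[h --> F] --> (0 : R) by exact: cvg_within.
have lim : f t + h *: (h^-1 *: (f (t + h) - f t)) @[h --> F] --> f t + 0 *: f' t.
  by apply: cvgD; [exact: cvg_cst | apply: cvgZ => //; exact: df].
rewrite scale0r addr0 in lim; apply: cvg_trans lim; apply: near_eq_cvg.
rewrite near_withinE; apply: nearW => h [h0 _] /=.
by rewrite scalerA divff // scale1r addrC subrK.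
Qed.

(** Product rule: the quotient of [b f g] splits exactly into one term with the quotient of [f]
    against [g (t + h)] and one with [f t] against the quotient of [g]. Boundedness of [b] and
    continuity of [g] at [t] give the limit. *)
Lemma deriv_on_symbil {H : normedModType R} (b : H -> H -> R) (C : R)
    (f f' g g' : R -> H) :
  sym_bilinear b -> (forall u v, `|b u v| <= C * `|u| * `|v|) ->
  deriv_on T f f' -> deriv_on T g g' ->
  deriv_on T (fun t => b (f t) (g t)) (fun t => b (f' t) (g t) + b (f t) (g' t)).
Proof.
move=> bS bC df dg t tT; set F := within _ _.
have FF : Filter F by apply: within_filter.
have lim : b (h^-1 *: (f (t + h) - f t)) (g (t + h)) +
    b (f t) (h^-1 *: (g (t + h) - g t)) @[h --> F] --> b (f' t) (g t) + b (f t) (g' t).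
  apply: cvgD; apply: (cvg_bounded_symbil b C) => //; [exact: df | | exact: cvg_cst | exact: dg].
  exact: deriv_on_cvg dg tT.
apply: cvg_trans lim; apply: near_eq_cvg; apply: nearW => h /=.
rewrite (symbilZl bS) (symbilZr bS) (symbilBl bS) (symbilBr bS).
by rewrite /GRing.scale /=; ring.
Qed.

(** Comparing increments rather than values lets the functions differ by a constant, as [<U,U>] and
    [<U,U> - I] do. *)
Lemma deriv_on_congr (f g f' g' : R -> R) :
  (forall x y, f x - f y = g x - g y) ->
  (forall t, 0 <= t < T -> f' t = g' t) ->
  deriv_on T f f' -> deriv_on T g g'.
Proof.
move=> fg f'g' df t tT; rewrite -f'g' //.
by under eq_fun do rewrite -fg; exact: df.
Qed.

Lemma deriv_onZ (c : R) (f f' : R -> R) :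
  deriv_on T f f' -> deriv_on T (fun t => c * f t) (fun t => c * f' t).
Proof.
move=> df t tT; set F := within _ _.
have FF : Filter F by apply: within_filter.
have lim : c * (h^-1 *: (f (t + h) - f t)) @[h --> F] --> c * f' t.
  by apply: cvgM; [exact: cvg_cst | exact: df].
apply: cvg_trans lim; apply: near_eq_cvg; apply: nearW => h /=.
by rewrite /GRing.scale /=; ring.
Qed.

Lemma deriv_on_sum (n : nat) (f f' : 'I_n -> R -> R) :
  (forall i, deriv_on T (f i) (f' i)) ->
  deriv_on T (fun t => \sum_i f i t) (fun t => \sum_i f' i t).
Proof.
move=> df t tT; set F := within _ _.
have FF : Filter F by apply: within_filter.
have lim : \sum_i h^-1 *: (f i (t + h) - f i t) @[h --> F] --> \sum_i f' i t.
  by apply: cvg_sumr => i; exact: df.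
apply: cvg_trans lim; apply: near_eq_cvg; apply: nearW => h /=.
by rewrite -scaler_sumr sumrB.
Qed.

(** * Preservation of positivity by a Lyapunov equation *)

(** If failures exist, [P] holds at their infimum, by the left condition or by [P 0]. The right
    condition then keeps failures at a positive distance, a contradiction. *)
Lemma real_induction (P : R -> Prop) :
  P 0 ->
  (forall s, 0 < s < T -> (forall r, 0 <= r < s -> P r) -> P s) ->
  (forall s, 0 <= s < T -> P s ->
     exists2 d, 0 < d & forall h, 0 < h < d -> s + h < T -> P (s + h)) ->
  forall t, 0 <= t < T -> P t.
Proof.
move=> P0 Pleft Pright t /andP[t0 tT]; apply: contrapT => nPt.
pose B := [set x | 0 <= x < T /\ ~ P x].
have Bt : B t by split=> //; rewrite t0.
have lbB : lbound B 0 by move=> x [/andP[]].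
have infB : has_inf B by split; [exists t | exists 0].
have s0 : 0 <= inf B by apply: lb_le_inf => //; exists t.
have st : inf B <= t by apply: ge_inf => //; exists 0.
have sT := le_lt_trans st tT.
have Plt r : 0 <= r < inf B -> P r.
  move=> /andP[r0 rs]; apply: contrapT => nPr.
  have : inf B <= r by apply: ge_inf; [exists 0|split=> //; rewrite r0 (lt_trans rs)].
  by rewrite leNgt rs.
have Ps : P (inf B).
  have := s0; rewrite le_eqVlt => /orP[/eqP<-//|s_gt0].
  by apply: Pleft => //; rewrite s_gt0.
have [|d d0 hd] := Pright _ _ Ps; first by rewrite s0.
have [x [/andP[x0 xT] nPx] xd] := inf_adherent d0 infB.
have sx : inf B <= x by apply: ge_inf; [exists 0|split=> //; rewrite x0].
have sx' : inf B < x.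
  by rewrite lt_neqAle sx andbT; apply/eqP => e; apply: nPx; rewrite -e.
apply: nPx; have -> : x = inf B + (x - inf B) by rewrite addrC subrK.
by apply: hd; rewrite ?subr_gt0 ?sx' ?ltrBlDl // addrC subrK.
Qed.

(* With [E t = D t + e (1 + t) I], the identity
   [E (s + h) = (1 - h K) E s (1 - h K) + h (e I + 2 e (1 + s) K + o(1))]
   shows that positivity of [E] propagates to the right. *)
Lemma lyapunov_psd (N : nat) (D K : R -> 'M[R]_N) :
  (forall i j, deriv_on T (fun t => D t i j)
     (fun t => (- (K t *m D t + D t *m K t)) i j)) ->
  (forall t, 0 <= t < T -> (K t)^T = K t /\ psd (K t)) ->
  psd (D 0) ->
  forall t, 0 <= t < T -> psd (D t).
Proof.
move=> dD hK D0.
(* The growing shift provides a margin [h * e] in each step to the right, enough to absorb the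
   remainder. Letting [e] tend to 0 recovers [D t]. *)
suff psdE e : 0 < e -> forall t, 0 <= t < T -> psd (D t + (e * (1 + t))%:M).
  move=> t tT v; set c := (1 + t) * (v^T *m v) 0 0.
  have c0 : 0 <= c.
    rewrite mulr_ge0 //; first by case/andP: tT => t0 _; rewrite addr_ge0.
    by rewrite mxE sumr_ge0 // => i _; rewrite mxE -expr2 sqr_ge0.
  apply/ler_addgt0Pr => d d0.
  (* With this value of [e] the shift contributes at most [d] to the quadratic form, even when
     [c = 0]. *)
  have e0 : 0 < d / (c + 1) by rewrite divr_gt0 // ltr_wpDl.
  have := psdE _ e0 t tT v.
  rewrite mulmxDr mulmxDl mul_mx_scalar -scalemxAl mxE [X in _ + X]mxE -mulrA -/c.
  move/le_trans; apply; rewrite lerD2l mulrAC ler_pdivrMr ?ltr_wpDl //.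
  by rewrite ler_pM2l // lerDl.
move=> e0; apply: real_induction.
- apply: psdD => //; rewrite -[X in psd X]addr0; apply: psd_scalar_perturb => i j.
  by rewrite mxE normr0 mulr0 addr0 mulr1 ltW.
(* A negative value of the quadratic form at [s] would persist at some [s - m] with [0 < m < s], by
   continuity, contradicting positivity before [s]. *)
- move=> s /andP[s0 sT] Pr v; rewrite leNgt; apply/negP => neg.
  have sT' : 0 <= s < T by rewrite ltW.
  pose F := within (fun h : R => h != 0 /\ 0 <= s + h < T) (nbhs 0).
  have FF : Filter F by apply: within_filter.
  have idF : h @[h --> F] --> (0 : R) by exact: cvg_within.
  pose E t := D t + (e * (1 + t))%:M.
  have Ecvg i j : E (s + h) i j @[h --> F] --> E s i j.
    have EE t : E t i j = D t i j + e * (1 + t) * (i == j)%:R.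
      by rewrite /E !mxE mulr_natr.
    under eq_fun do rewrite EE.
    rewrite EE; apply: cvgD; first exact: deriv_on_cvg (dD i j) sT'.
    apply: cvgM; last exact: cvg_cst.
    apply: cvgM; first exact: cvg_cst.
    apply: cvgD; first exact: cvg_cst.
    by rewrite -[X in _ --> X]addr0; apply: cvgD => //; exact: cvg_cst.
  have qcvg : (v^T *m E (s + h) *m v) 0 0 @[h --> F] --> (v^T *m E s *m v) 0 0.
    under eq_fun do rewrite quad_formE.
    rewrite quad_formE; apply: cvg_sumr => j; apply: cvg_sumr => i.
    apply: cvgM; last exact: cvg_cst.
    by apply: cvgM => //; exact: cvg_cst.
  have : \forall h \near F, (v^T *m E (s + h) *m v) 0 0 < 0 by exact: cvgr_lt qcvg _ neg.
  rewrite near_withinE.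
  move=> /nbhs_ballP[d /= d0 hd].
  pose m := Num.min d s / 2.
  have [md ms m0] : [/\ m < d, m < s & 0 < m].
    have mn0 : 0 < Num.min d s by rewrite lt_min d0 s0.
    have mn : m < Num.min d s by rewrite /m; move: (Num.min d s) mn0 => x x0; lra.
    split; last exact: divr_gt0.
      by apply: lt_le_trans mn _; rewrite ge_min lexx.
    by apply: lt_le_trans mn _; rewrite ge_min lexx orbT.
  have : (v^T *m E (s - m) *m v) 0 0 < 0.
    apply: hd; first by rewrite /ball /= sub0r opprK gtr0_norm.
    split; first by rewrite oppr_eq0 gt_eqF.
    by rewrite subr_ge0 ltW //= (lt_trans _ sT) // ltrBlDr ltrDl.
  apply/negP; rewrite -leNgt; apply: Pr.
  by rewrite subr_ge0 ltW //= ltrBlDr ltrDl.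
- move=> s sT Es; have [Ksym Kpsd] := hK s sT.
  set c := e * (1 + s) in Es.
  have c0 : 0 <= c by case/andP: sT => s0 _; rewrite mulr_ge0 ?addr_ge0 // ltW.
  pose F := within (fun h : R => h != 0 /\ 0 <= s + h < T) (nbhs 0).
  have FF : Filter F by apply: within_filter.
  have idF : h @[h --> F] --> (0 : R) by exact: cvg_within.
  pose KEK := K s *m (D s + c%:M) *m K s.
  pose L := K s *m D s + D s *m K s.
  (* [Q] is the remainder [o(1)]: the quotient tends to [- L], and the last term removes the
     second-order part of the congruence by [1 - h K]. *)
  pose Q h := h^-1 *: (D (s + h) - D s) + L - h *: KEK.
  have Qcvg i j : N%:R * `|Q h i j| @[h --> F] --> 0.
    rewrite -(mulr0 N%:R); apply: cvgM; first exact: cvg_cst.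
    apply/norm_cvg0P.
    have -> : 0 = (- L) i j + L i j - 0 * KEK i j :> R by rewrite !mxE; ring.
    have -> : (fun h => Q h i j) = (fun h => h^-1 *: (D (s + h) i j - D s i j) +
        L i j - h * KEK i j).
      by apply/funext => h; rewrite /Q !mxE.
    apply: cvgB; last by apply: cvgM => //; exact: cvg_cst.
    by apply: cvgD; [exact: dD|exact: cvg_cst].
  have : \forall h \near F, forall i, forall j, N%:R * `|Q h i j| < e.
    apply: filter_forall => i; apply: filter_forall => j.
    exact: cvgr_lt (Qcvg i j) _ e0.
  rewrite near_withinE => /nbhs_ballP[d /= d0 hd].
  exists d => // h /andP[h0 hd'] shT.
  have hn0 : h != 0 by rewrite gt_eqF.
  have Qlt : forall i j, N%:R * `|Q h i j| < e.
    apply: hd; first by rewrite /ball /= sub0r normrN gtr0_norm.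
    by split=> //; case/andP: sT => s0 _; rewrite shT addr_ge0 // ltW.
  have -> : D (s + h) + (e * (1 + (s + h)))%:M =
      (1%:M - h *: K s)^T *m (D s + c%:M) *m (1%:M - h *: K s) +
      h *: ((e%:M + Q h) + (2 * c) *: K s).
    have -> : (1%:M - h *: K s)^T = 1%:M - h *: K s.
      by rewrite linearB linearZ /= tr_scalar_mx Ksym.
    rewrite mulmxBl mul1mx mulmxBr mulmx1 mulmxBl.
    rewrite -!scalemxAl -!scalemxAr -/KEK mulmxDr mulmxDl.
    rewrite mul_mx_scalar mul_scalar_mx /Q /L /c.
    move: (KEK) (K s *m D s) (D s *m K s) => X1 X2 X3.
    apply/matrixP => i j; rewrite !mxE; case: (i == j);
      rewrite ?mulr1n ?mulr0n; field; exact: hn0.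
  apply: psdD; first exact: psd_congr.
  apply: psdZ; first exact: ltW.
  apply: psdD; last by apply: psdZ => //; exact: mulr_ge0.
  by apply: psd_scalar_perturb => i j; exact: ltW.
Qed.

End DerivOn.
End Limits.

(** * Decay of the energy *)

Lemma green_gram_trace_le {R : realType} {H : normedModType R}
    (ip a : H -> H -> R) (G : H -> H) (N : nat) (u : 'I_N -> H) :
  sym_bilinear a -> sym_bilinear ip -> (forall x, x != 0 -> 0 < a x x) ->
  green_op a ip G -> psd (gram ip u u - 1%:M) ->
  \tr (gram ip u u) <=
  \sum_i \sum_k gram ip (tmap G u) u k i * a (u k) (u i).
Proof.
move=> aS ipS a_gt0 aG hD; set S := gram ip u u.
have -> : \sum_i \sum_k gram ip (tmap G u) u k i * a (u k) (u i) =
    \sum_i \sum_j a (G (u i)) (G (u j)) * a (u i) (u j).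
  apply: eq_bigr => i _; apply: eq_bigr => k _.
  by rewrite mxE aG (symbilC ipS (u i)) (symbilC aS (u k)).
apply: le_trans (gram_swap_le aS N u (fun i => G (u i)) a_gt0).
have -> : \sum_i \sum_j a (G (u i)) (u j) * a (u i) (G (u j)) =
    \sum_i \sum_j S i j ^+ 2.
  apply: eq_bigr => i _; apply: eq_bigr => j _.
  by rewrite mxE (symbilC aS (u i)) !aG (symbilC ipS (u j)) expr2.
(* [|S|^2 - tr S = |S - 1|^2 + tr (S - 1)] *)
rewrite -subr_ge0.
have -> : \sum_i \sum_j S i j ^+ 2 - \tr S =
    \sum_i \sum_j (S - 1%:M) i j ^+ 2 + \tr (S - 1%:M).
  rewrite -sumrB -big_split; apply: eq_bigr => i _ /=.
  rewrite (bigD1 i) //= [in RHS](bigD1 i) //= !mxE eqxx mulr1n.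
  under [in RHS]eq_bigr => j /negPf ji do
    rewrite mxE [X in _ + X]mxE [X in _ - X]mxE eq_sym ji subr0.
  ring.
apply: addr_ge0; last exact: psd_trace_ge0.
by apply: sumr_ge0 => i _; apply: sumr_ge0 => j _; exact: sqr_ge0.
Qed.

Theorem theorem3p3 (R : realType) (H : completeNormedModType R)
  (ip a : H -> H -> R) (G : H -> H) (N : nat) (T : R)
  (U : 'I_N -> R -> H) (U0 : 'I_N -> H) :
  hilbert_norm H -> L2_inner ip -> coercive_form a -> green_op a ip G ->
  0 < T ->
  (* U in C^1([0,T); H^N) solving dU/dt = GU - U <GU,U>, U(0) = U0 *)
  (exists U' : 'I_N -> R -> H,
     (forall i, deriv_on T (U i) (U' i) /\ continuous_on_0T T (U' i)) /\
     (forall t, 0 <= t < T -> forall j,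
        U' j t = tmap G (fun i => U i t) j
                 - tmul (fun i => U i t)
                        (gram ip (tmap G (fun i => U i t)) (fun i => U i t)) j)) ->
  (forall i, U i 0 = U0 i) ->
  quasi_stiefel ip U0 ->
  (* d/dt E(U(t)) exists and is <= 0 on [0,T) *)
  exists dE : R -> R,
    deriv_on T (fun t => energy a (fun i => U i t)) dE /\
    (forall t, 0 <= t < T -> dE t <= 0).
Proof.
move=> _ [ipS ip_gt0 [Ci [Ci0 ipC]]] [aS [c1 [c2 [c10 c20 ac]]]] aG T0.
move=> [U' [dU U'E]] U00 hU0.
have a_gt0 u : u != 0 -> 0 < a u u.
  move=> u0; apply: lt_le_trans (ac u).1.
  by rewrite mulr_gt0 // exprn_gt0 // normr_gt0.
have ipB := bounded_symbil_norm ip Ci ipS ip_gt0 (ltW Ci0) ipC.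
have aB := bounded_symbil_norm a c2 aS a_gt0 (ltW c20) (fun u => (ac u).2).
pose u t i := U i t.
pose K t := gram ip (tmap G (u t)) (u t).
pose D t := gram ip (u t) (u t) - 1%:M.
(* As an [a]-Gram matrix of [GU], [K] is symmetric and positive semidefinite, as the Lyapunov
   argument requires. *)
have KE t : K t = gram a (tmap G (u t)) (tmap G (u t)).
  by apply/matrixP => i j; rewrite !mxE (symbilC aS) aG (symbilC ipS).
have Ksym t : (K t)^T = K t.
  by rewrite KE; apply/matrixP => i j; rewrite !mxE (symbilC aS).
have D_psd t : 0 <= t < T -> psd (D t).
  apply: (lyapunov_psd T N D K) => [i j|s _|].
  - apply: deriv_on_congr (deriv_on_symbil T ip Ci _ _ _ _ ipS ipB (dU i).1 (dU j).1).
      by move=> x y; rewrite !mxE; ring.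
    (* [P] collects the products of [U'] with [U]. The flow yields the transpose of [K s], removed
       by symmetry, and the derivative of the Gram matrix is [P + P^T]. *)
    move=> s sT; pose P := K s - K s *m gram ip (u s) (u s).
    have Ssym : (gram ip (u s) (u s))^T = gram ip (u s) (u s).
      by apply/matrixP => m n; rewrite !mxE (symbilC ipS).
    have ipU' m n : ip (U' m s) (U n s) = P m n.
      rewrite U'E // (symbilBl ipS) (symbil_suml ipS) mxE [X in _ = _ + X]mxE.
      rewrite [K s m n]mxE; congr (_ - _); rewrite mxE.
      apply: eq_bigr => k _; rewrite (symbilZl ipS) -[in RHS]Ksym.
      by rewrite [(K s)^T _ _]mxE [gram ip (u s) (u s) _ _]mxE.
    rewrite (symbilC ipS (U i s)) !ipU'.
    have -> : - (K s *m D s + D s *m K s) = P + P^T.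
      rewrite /P /D [(_ - _)^T]linearB /= trmx_mul Ksym Ssym mulmxBr mulmxBl mulmx1 mul1mx.
      move: (K s) (K s *m _) (_ *m K s) => X1 X2 X3.
      by apply/matrixP => m n; rewrite !mxE; ring.
    by move: (P) => Q; rewrite !mxE.
  - by rewrite Ksym; split=> //; rewrite KE; apply: gram_psd => // x; exact: posdef_ge0.
  - rewrite /D /u; have -> : (fun i => U i 0) = U0 by apply/funext.
    exact: hU0.
(* Symmetry of [a] merges the two terms of the product rule and cancels the factor [2^-1] of the
   energy. *)
exists (fun t => \sum_i a (U' i t) (U i t)); split.
  have dE := deriv_onZ T 2^-1 _ _ (deriv_on_sum T N _ _ (fun i =>
    deriv_on_symbil T a c2 _ _ _ _ aS aB (dU i).1 (dU i).1)).
  apply: deriv_on_congr dE => [x y|t tT].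
    by congr (_ * _ - _ * _); apply: eq_bigr => i _; rewrite mxE.
  rewrite mulr_sumr; apply: eq_bigr => i _.
  by rewrite (symbilC aS (U i t)); field.
move=> t tT.
under eq_bigr => i _ do rewrite U'E // (symbilBl aS) (symbil_suml aS).
rewrite sumrB subr_le0.
(* The part of [dE] coming from [GU] is exactly the trace of [<U,U>], since [a (G v) v = ip v v];
   the part from [U <GU,U>] is the double sum bounded below by it. *)
have := green_gram_trace_le ip a G N (u t) aS ipS a_gt0 aG (D_psd t tT).
congr (_ <= _).
  by apply: eq_bigr => i _; rewrite mxE aG.
by apply: eq_bigr => i _; apply: eq_bigr => k _; rewrite (symbilZl aS).
Qed.
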